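(* Let $K$ be a field. Then the following conditions are equivalent: 1. there exist a field $L$ containing $K$ and two derivations from $K$ to $L$ whose kernels are incomparable with respect to inclusion; 2. there exist a noncommutative ring $R$ and an ideal $I$ of $R$ such that $I$ is central in $R$, $R/I \simeq K$ and $I^2 = 0$; 3. there exist a noncommutative ring $R$ and an ideal $I$ of $R$ such that $I$ is commutative as a ring, $I = I^2$ and $R/I \simeq K$; 4. there exist a noncommutative ring $R$ and an ideal $I$ of $R$ such that $I$ is central in $R$ and $R/I \simeq K$.
   Context: All rings are associative but not necessarily with unity; ideals are two-sided; $\simeq$ denotes ring isomorphism. An ideal $I$ of $R$ is central in $R$ if $I$ is contained in the center $Z(R)$ of $R$. $I^2$ denotes the ideal product, i.e. the additive subgroup generated by all products $ij$ with $i,j\in I$. For a field $L$ containing $K$, a derivation $d : K \to L$ is a map with $d(x+y) = d(x)+d(y)$ and $d(xy) = x\,d(y) + d(x)\,y$ for all $x,y \in K$; its kernel is $K^d=\{r\in K \mid d(r)=0\}$. Two kernels are incomparable if neither is contained in the other. *)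

(* Defs.v *)
From HB Require Import structures.
From mathcomp Require Import all_boot all_algebra.
From mathcomp Require Import generic_quotient ring_quotient.

Set Implicit Arguments.
Unset Strict Implicit.
Unset Printing Implicit Defensive.

Import GRing.Theory.

Local Open Scope ring_scope.
Local Open Scope quotient_scope.

(* MathComp rings all have a unit, so associative rings not necessarily with   *)
(* unity are introduced as an extension of zmodType. Their product is written  *)
(* x ** y, the notation x * y being reserved to unital rings.                  *)
HB.mixin Record Zmodule_isRng R of GRing.Zmodule R := {
  rngmul : R -> R -> R;
  rngmulA : associative rngmul;
  rngmulDl : left_distributive rngmul +%R;
  rngmulDr : right_distributive rngmul +%R
}.

#[short(type="rngType")]
HB.structure Definition Rng := {R of Zmodule_isRng R & GRing.Zmodule R}.

Notation "x ** y" := (rngmul x y) (at level 40, left associativity) : ring_scope.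

Section RngTheory.
Variable R : rngType.
Implicit Types x y z : R.

Lemma rngmulBl x y z : (x - y) ** z = x ** z - y ** z.
Proof. by apply/eqP; rewrite eq_sym subr_eq -rngmulDl subrK. Qed.

Lemma rngmulBr x y z : x ** (y - z) = x ** y - x ** z.
Proof. by apply/eqP; rewrite eq_sym subr_eq -rngmulDr subrK. Qed.

End RngTheory.

Definition as_rng (A : pzRingType) : Type := A.
HB.instance Definition _ (A : pzRingType) := GRing.Zmodule.on (as_rng A).
HB.instance Definition _ (A : pzRingType) :=
  Zmodule_isRng.Build (as_rng A) (@mulrA A) (@mulrDl A) (@mulrDr A).

Definition noncommutative (R : rngType) : Prop := ~ commutative (@rngmul R).

Definition rng_isomorphic (R S : rngType) : Prop :=
  exists f : R -> S,
    [/\ bijective f,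
        {morph f : x y / x + y >-> x + y}
      & {morph f : x y / x ** y >-> x ** y}].

(* Unlike in idealr, the ideal is not required to be proper. *)
HB.mixin Record isRngIdeal (R : rngType) (I : R -> bool) := {
  rng_idealMl : forall a : R, {in I, forall x, a ** x \in I};
  rng_idealMr : forall a : R, {in I, forall x, x ** a \in I}
}.

#[short(type="rngIdeal")]
HB.structure Definition RngIdeal (R : rngType) :=
  {I of GRing.ZmodClosed R I & isRngIdeal R I}.

(* The product of the quotient group {quot I} by a two-sided ideal. *)
Section RngQuotient.
Variables (R : rngType) (I : rngIdeal R).
Local Notation Q := (Quotient.quot I).

Definition quot_mul : Q -> Q -> Q := lift_op2 Q (@rngmul R).

Lemma pi_quot_mul : {morph \pi_Q : x y / x ** y >-> quot_mul x y}.
Proof.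
move=> x y; unlock quot_mul; apply/eqP; rewrite piE Quotient.equivE.
set x' := repr _; set y' := repr _.
have -> : x ** y - x' ** y' = (x - x') ** y + x' ** (y - y').
  by rewrite rngmulBl rngmulBr addrA subrK.
rewrite rpredD //.
  by apply: rng_idealMr; rewrite Quotient.idealrBE reprK.
by apply: rng_idealMl; rewrite Quotient.idealrBE reprK.
Qed.
Canonical pi_quot_mul_morph := PiMorph2 pi_quot_mul.

Lemma quot_mulA : associative quot_mul.
Proof. by move=> x y z; rewrite -[x]reprK -[y]reprK -[z]reprK !piE rngmulA. Qed.

Lemma quot_mulDl : left_distributive quot_mul +%R.
Proof. by move=> x y z; rewrite -[x]reprK -[y]reprK -[z]reprK !piE rngmulDl. Qed.

Lemma quot_mulDr : right_distributive quot_mul +%R.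
Proof. by move=> x y z; rewrite -[x]reprK -[y]reprK -[z]reprK !piE rngmulDr. Qed.

HB.instance Definition _ := Zmodule_isRng.Build Q quot_mulA quot_mulDl quot_mulDr.

End RngQuotient.

Definition in_center (R : rngType) (x : R) : Prop := forall y, x ** y = y ** x.

Definition central_ideal (R : rngType) (I : rngIdeal R) : Prop :=
  forall x, x \in I -> in_center x.

Definition commutative_ideal (R : rngType) (I : rngIdeal R) : Prop :=
  {in I &, commutative (@rngmul R)}.

(* The additive subgroup generated by the products of an element of I by an    *)
(* element of J.                                                               *)
Inductive ideal_prod (R : rngType) (I J : rngIdeal R) : R -> Prop :=
  | ideal_prod_mul i j of i \in I & j \in J : ideal_prod I J (i ** j)
  | ideal_prod0 : ideal_prod I J 0
  | ideal_prodB x y of ideal_prod I J x & ideal_prod I J y :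
      ideal_prod I J (x - y).

(* A field L containing K is given by a field morphism iota : K -> L, which    *)
(* is automatically injective.                                                 *)
Definition derivation (K L : fieldType) (iota : {rmorphism K -> L})
    (d : K -> L) : Prop :=
  (forall x y, d (x + y) = d x + d y) /\
  (forall x y, d (x * y) = iota x * d y + d x * iota y).

Definition der_kernel (K L : fieldType) (d : K -> L) : {pred K} :=
  [pred r | d r == 0].

Definition incomparable (T : Type) (A B : {pred T}) : Prop :=
  ~ {subset A <= B} /\ ~ {subset B <= A}.

(* Main.v *)
(* If I is central and R/I is a field K, commutators in R are killed by I, so *)
(* they span a K-vector space on which [x, y] induces an alternating *)
(* biderivation of K. Composing it with a functional that does not vanish on *)
(* [a, b] <> 0 gives derivations phi [_, a] and phi [_, b] of K with *)
(* incomparable kernels. *)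
(* Conversely, given derivations d1, d2 : K -> L, a commutative L-algebra Q, *)
(* an ideal m of Q and s in m with s m = 0, the group K * m is a ring for *)
(*   (a, x) (b, y) = (a b, a y + b x + x y + d1 a * d2 b * s), *)
(* with central ideal m; it is not commutative when the kernels of d1 and d2 *)
(* are incomparable. It remains to choose m with m^2 = 0 or with m^2 = m. *)
(* Both exist in the ring Q of germs at infinity of sequences in the product *)
(* of the L[X]/(X^(n+1)), where s is the germ of X^n: take m = Q s, resp. the *)
(* germs whose order of vanishing is at least linear in n. *)

Require Import Defs.
From HB Require Import structures.
From mathcomp Require Import all_boot all_algebra.
From mathcomp Require Import generic_quotient ring_quotient.
From mathcomp Require Import boolp classical_sets functions.
From mathcomp Require Import zify ring.

Set Implicit Arguments.
Unset Strict Implicit.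
Unset Printing Implicit Defensive.

Import GRing.Theory.

Local Open Scope ring_scope.
Local Open Scope quotient_scope.

(** The conditions are linked in the cycle 1, 2, 3, 4, 1. From 4 to 1
    ([central_kernel_derivations]), centrality turns the commutator into a biderivation
    ([rng_comm_mul]) whose values form vectors over K ([rng_comm_p_vector]); a functional from
    [exists_functional] makes it K-valued, so L = K suffices. Conditions 2 and 3 come from one
    construction. The product d1 a * d2 b * s is a Hochschild cocycle, which gives associativity
    ([ext_mulA]). As Q is commutative, only the asymmetry of this cocycle can prevent commutativity,
    and incomparable kernels provide it ([derivation_cocycle_asym]). The two cases differ only in m
    ([germ_ideal_sqr0], [germ_ideal_idempotent]). From 2 to 3 one returns to 1 and builds a new
    ring; from 3 to 4 one uses [idempotent_commutative_central]. *)

Lemma rngmulx0 (R : rngType) (x : R) : x ** 0 = 0.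
Proof. by rewrite -{1}(subrr x) rngmulBr subrr. Qed.

Lemma rngmul0x (R : rngType) (x : R) : 0 ** x = 0.
Proof. by rewrite -{1}(subrr x) rngmulBl subrr. Qed.

Lemma rngmulN (R : rngType) (x y : R) : x ** (- y) = - (x ** y).
Proof. by rewrite -sub0r rngmulBr rngmulx0 sub0r. Qed.

(** * Quotients as surjections with a section *)

Lemma quot_isomorphism (R S : rngType) (I : rngIdeal R)
    (p : R -> S) (g : S -> R) :
    {morph p : x y / x + y} -> {morph p : x y / x ** y} -> cancel g p ->
    (forall x, (x \in I) = (p x == 0)) ->
  rng_isomorphic (Quotient.quot I) S.
Proof.
move=> pD pM gK ker_p.
have p0 : p 0 = 0 by apply: (addrI (p 0)); rewrite -pD !addr0.
have pB x y : p (x - y) = p x - p y by rewrite -{2}(subrK y x) [in RHS]pD addrK.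
have p_repr x : p (repr (\pi_(Quotient.quot I) x)) = p x.
  apply/eqP; rewrite -subr_eq0 -pB -ker_p Quotient.idealrBE; apply/eqP.
  exact: reprK.
exists (fun x => p (repr x)); split.
- exists (fun a => \pi_(Quotient.quot I) (g a)) => [x|a].
  2: by rewrite p_repr.
  rewrite -[x in RHS]reprK; apply/eqP.
  by rewrite -Quotient.idealrBE ker_p pB gK subrr.
- move=> x y; rewrite -pD -[in RHS]p_repr; congr (p (repr _)).
  rewrite raddfD; congr (_ + _); symmetry; exact: reprK.
- move=> x y; rewrite -pM -[in RHS]p_repr; congr (p (repr _)).
  rewrite pi_quot_mul; congr (quot_mul _ _); symmetry; exact: reprK.
Qed.

(** Replaces the quotient by a surjection [p] with kernel I; the section [g] merely picks preimages
    and need not be a morphism. *)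
Lemma quot_isomorphic_epi (R S : rngType) (I : rngIdeal R) :
    rng_isomorphic (Quotient.quot I) S ->
  exists p : R -> S, exists g : S -> R,
    [/\ {morph p : x y / x + y}, {morph p : x y / x ** y}, cancel g p
      & forall x, (x \in I) = (p x == 0)].
Proof.
move=> [f [[h fK hK] fD fM]].
have f0 : f 0 = 0 by apply: (addrI (f 0)); rewrite -fD !addr0.
exists (fun x => f (\pi x)); exists (fun a => repr (h a)); split.
- by move=> x y; rewrite raddfD fD.
- by move=> x y /=; rewrite pi_quot_mul fM.
- by move=> a; rewrite reprK hK.
move=> x; rewrite -f0 (can_eq fK) -[x in LHS]subr0 Quotient.idealrBE.
by rewrite raddf0.
Qed.

(** * Commutators modulo a central ideal *)

Definition rng_comm (R : rngType) (x y : R) : R := x ** y - y ** x.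

Lemma rng_commBl (R : rngType) (x y z : R) :
  rng_comm (x - y) z = rng_comm x z - rng_comm y z.
Proof. by rewrite /rng_comm rngmulBl rngmulBr !opprD !opprK addrACA. Qed.

Lemma rng_commDl (R : rngType) (x y z : R) :
  rng_comm (x + y) z = rng_comm x z + rng_comm y z.
Proof. by rewrite /rng_comm rngmulDl rngmulDr opprD addrACA. Qed.

Lemma rng_commC (R : rngType) (x y : R) : rng_comm x y = - rng_comm y x.
Proof. by rewrite /rng_comm opprB. Qed.

Section CentralKernel.
Variables (R : rngType) (K : fieldType) (p : R -> as_rng K) (g : as_rng K -> R).
Hypothesis pD : {morph p : x y / x + y}.
Hypothesis pM : {morph p : x y / x ** y}.
Hypothesis gK : cancel g p.
Hypothesis centralp : forall x, p x = 0 -> in_center x.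

Let pB x y : p (x - y) = p x - p y.
Proof. by rewrite -{2}(subrK y x) [in RHS]pD addrK. Qed.
Let pM' x y : p (x ** y) = (p x : K) * p y. Proof. exact: pM. Qed.

Lemma rng_comm_ker (x y : R) : p x = 0 -> rng_comm x y = 0.
Proof. by move=> /centralp cx; rewrite /rng_comm cx subrr. Qed.

Lemma eq_rng_comm (x x' y : R) : p x = p x' -> rng_comm x y = rng_comm x' y.
Proof.
move=> exx'; apply/eqP; rewrite -subr_eq0 -rng_commBl; apply/eqP.
by apply: rng_comm_ker; rewrite pB exx' subrr.
Qed.

Lemma rng_comm_central (x y : R) : in_center (rng_comm x y).
Proof. by apply: centralp; rewrite pB !pM' mulrC subrr. Qed.

(** Leibniz's rule produces [x, z] y; as K is commutative, [x, z] lies in the kernel of [p], hence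
    is central, and y can be moved to the left. *)
Lemma rng_comm_mul (x y z : R) :
  rng_comm (x ** y) z = x ** rng_comm y z + y ** rng_comm x z.
Proof.
rewrite -(rng_comm_central x z y) /rng_comm rngmulBr rngmulBl !rngmulA.
by rewrite addrA subrK.
Qed.

(** Both x and x y lie in the central kernel, so [x, z] and [x y, z] vanish and Leibniz's rule
    leaves only this term. *)
Lemma ker_mul_rng_comm (x y z : R) : p x = 0 -> x ** rng_comm y z = 0.
Proof.
move=> px0; have := rng_comm_mul x y z.
rewrite (@rng_comm_ker x) // rngmulx0 addr0 => <-.
by apply: rng_comm_ker; rewrite pM' px0 mul0r.
Qed.

(* R acts on v through p, making v a vector over K. *)
Definition p_vector (v : R) : Prop :=
  (forall x, p x = 0 -> x ** v = 0) /\ (forall x, p x = 1 -> x ** v = v).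

Lemma p_vector_eq (x y v : R) : p_vector v -> p x = p y -> x ** v = y ** v.
Proof.
move=> [v0 _] exy; apply/eqP; rewrite -subr_eq0 -rngmulBl v0 //.
by rewrite pB exy subrr.
Qed.

Lemma p_vectorB (u v : R) : p_vector u -> p_vector v -> p_vector (u - v).
Proof.
move=> [u0 u1] [v0 v1]; split=> x px; rewrite rngmulBr.
  by rewrite u0 // v0 // subrr.
by rewrite u1 // v1.
Qed.

Lemma p_vectorM (x v : R) : p_vector v -> p_vector (x ** v).
Proof.
move=> vV; split=> y py; rewrite rngmulA.
  by apply: vV.1; rewrite pM' py mul0r.
by apply: p_vector_eq => //; rewrite pM' py mul1r.
Qed.

(* With e a lift of 1, [e, z] = [e e, z] = 2 e [e, z] forces [e, z] = 0. *)
Lemma rng_comm_p_vector (y z : R) : p_vector (rng_comm y z).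
Proof.
split=> [x|e pe]; first exact: ker_mul_rng_comm.
have pee : p (e ** e) = p e by rewrite pM' pe mulr1.
have e2 : rng_comm e z = e ** rng_comm e z + e ** rng_comm e z.
  by rewrite -rng_comm_mul; apply: eq_rng_comm.
have ee : e ** (e ** rng_comm e z) = e ** rng_comm e z.
  rewrite rngmulA; apply/eqP; rewrite -subr_eq0 -rngmulBl; apply/eqP.
  by apply: ker_mul_rng_comm; rewrite pB pee subrr.
have ez0 : e ** rng_comm e z = 0.
  have := congr1 (rngmul e) e2; rewrite [in RHS]rngmulDr !ee => /eqP.
  by rewrite -subr_eq subrr => /eqP <-.
have {e2}ez : rng_comm e z = 0 by rewrite e2 ez0 addr0.
have : rng_comm (e ** y) z = rng_comm y z.
  by apply: eq_rng_comm; rewrite pM' pe mul1r.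
by rewrite rng_comm_mul ez rngmulx0 addr0.
Qed.

(** * A K-linear functional that does not vanish on a given vector *)

Section Functional.
Variable v0 : R.
Hypotheses (v0V : p_vector v0) (v0_neq0 : v0 <> 0).

(* A maximal left submodule avoiding v0 is such a W: if u is not in W, then *)
(* v0 = w + r u with w in W and p r <> 0, since r u = 0 otherwise. *)
Lemma complement_line : exists W : set R,
  [/\ W 0, forall x y, W x -> W y -> W (x - y), forall r x, W x -> W (r ** x),
      ~ W v0
    & forall u, p_vector u -> exists r, W (u - r ** v0)].
Proof.
(* [W 0] is left out because the empty chain has empty union; it is recovered from maximality, since
   a W without 0 would be empty and properly contained in {0}. *)
pose P (W : set R) := [/\ forall x y, W x -> W y -> W (x - y),
  forall r x, W x -> W (r ** x) & ~ W v0].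
have [|W [[WB WM Wv0] Wmax]] := @Zorn_bigcup R P.
  move=> F FP Ftot; split.
  - move=> x y [A FA Ax] [B FB By].
    have [AB|BA] := Ftot _ _ FA FB.
      by exists B => //; have [+ _ _] := FP _ FB; apply=> //; apply: AB.
    by exists A => //; have [+ _ _] := FP _ FA; apply=> //; apply: BA.
  - by move=> r x [A FA Ax]; exists A => //; have [_ + _] := FP _ FA; apply.
  - by move=> [A FA Av0]; have [_ _] := FP _ FA; apply.
have W0 : W 0.
  apply: contrapT => W0n.
  have We x : ~ W x by move=> Wx; apply: W0n; rewrite -(subrr x); apply: WB.
  apply: (Wmax [set 0]%classic); first by split=> [x /We //|/(_ 0 erefl) /W0n].
  split=> [x y -> ->|r x ->|]; rewrite /= ?subrr ?rngmulx0 //.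
exists W; split=> // u uV.
have [Wu|nWu] := pselect (W u); first by exists 0; rewrite rngmul0x subr0.
pose B : set R := fun x => exists w r, W w /\ x = w + r ** u.
have WB' : (W `<` B)%classic.
  split=> [x Wx|BW]; first by exists x, 0; rewrite rngmul0x addr0.
  apply: nWu; apply: BW; exists 0, (g 1); split=> //.
  by rewrite add0r uV.2 // gK.
have [w [r [Ww v0E]]] : B v0.
  apply: contrapT => Bv0; apply: (Wmax B WB'); split=> //.
  - move=> _ _ [x [r [Wx ->]]] [y [s [Wy ->]]]; exists (x - y), (r - s).
    by split; [apply: WB|rewrite rngmulBl opprD addrACA].
  - move=> t _ [x [r [Wx ->]]]; exists (t ** x), (t ** r).
    by split; [apply: WM|rewrite rngmulDr rngmulA].
have pr0 : (p r : K) != 0.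
  apply/eqP => pr0; apply: Wv0; rewrite v0E (uV.1 r) //.
  by rewrite addr0.
pose s : R := g ((p r : K)^-1).
(* As s r lifts 1, s v0 = s w + u, so u - s v0 = - s w lies in W. *)
exists s; rewrite v0E rngmulDr rngmulA (uV.2 (s ** r)); last first.
  by rewrite pM' gK mulVf.
by rewrite opprD addrCA subrr addr0 -sub0r; apply: WB => //; apply: WM.
Qed.

(** The functional is the coordinate along v0 modulo W. Its lift [h u] to R is not unique, but its
    image in K is, which gives linearity. *)
Lemma exists_functional : exists phi : R -> K,
  [/\ forall u v, p_vector u -> p_vector v -> phi (u - v) = phi u - phi v,
      forall x v, p_vector v -> phi (x ** v) = (p x : K) * phi v
    & phi v0 = 1].
Proof.
have [W [W0 WB WM Wv0 Wex]] := complement_line.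
have /choice[h hW] : forall u, exists r, p_vector u -> W (u - r ** v0).
  move=> u; have [/Wex[r Wr]|nV] := pselect (p_vector u); first by exists r.
  by exists 0 => /nV.
have uniq_h u r : p_vector u -> W (u - r ** v0) -> p (h u) = p r.
  (* Two distinct coordinates would put a nonzero multiple of v0 in W, and inverting the scalar
     would put v0 there. *)
  move=> uV Wur; apply: contrapT => /eqP nhr; apply: Wv0.
  have nz : (p (h u) - p r : K) != 0 by rewrite subr_eq0.
  have -> : v0 = g ((p (h u) - p r : K)^-1) ** ((h u - r) ** v0).
    by rewrite rngmulA [RHS](v0V.2 _) // pM' gK pB mulVf.
  apply: WM; have -> : (h u - r) ** v0 = (u - r ** v0) - (u - h u ** v0).
    by rewrite rngmulBl opprB [RHS]addrC addrA subrK.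
  by apply: WB => //; apply: hW.
exists (fun u => p (h u)); split.
- move=> u v uV vV; rewrite -[RHS]pB; apply: uniq_h; first exact: p_vectorB.
  by rewrite rngmulBl opprD addrACA -opprD; apply: WB; exact: hW.
- move=> x v vV; rewrite -pM'; apply: uniq_h; first exact: p_vectorM.
  by rewrite -rngmulA -rngmulBr; apply/WM/hW.
rewrite -(gK 1); apply: uniq_h => //.
by rewrite v0V.2 ?gK // subrr.
Qed.

End Functional.

Lemma central_kernel_derivations : noncommutative R ->
  exists (L : fieldType) (iota : {rmorphism K -> L}) (d1 d2 : K -> L),
    [/\ derivation iota d1, derivation iota d2
      & incomparable (der_kernel d1) (der_kernel d2)].
Proof.
move=> ncR.
have [a [b ab]] : exists a b : R, rng_comm a b <> 0.
  apply: contrapT => nab; apply: ncR => a b; apply: contrapT => nc.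
  by apply: nab; exists a, b => /eqP; rewrite subr_eq0 => /eqP.
have [phi [phiB phiM phi1]] := exists_functional (rng_comm_p_vector a b) ab.
have V := rng_comm_p_vector.
have phi0 : phi 0 = 0.
  by rewrite -(subrr (rng_comm a b)) phiB // subrr.
have V0 : p_vector 0 by rewrite -(subrr (rng_comm a b)); apply: p_vectorB.
have phiN y z : phi (- rng_comm y z) = - phi (rng_comm y z).
  by rewrite -sub0r phiB // phi0 sub0r.
pose d c (k : K) : K := phi (rng_comm (g k) c).
have der c : derivation (idfun : {rmorphism K -> K}) (d c).
  split=> x y; rewrite /d.
    (* [phi] is only known to respect differences, so sums are rewritten by antisymmetry. *)
    have -> : rng_comm (g (x + y)) c = rng_comm (g x) c - rng_comm c (g y).
      by rewrite -rng_commC -rng_commDl; apply: eq_rng_comm; rewrite pD !gK.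
    by rewrite phiB // (rng_commC c) phiN opprK.
  have -> : rng_comm (g (x * y)) c
      = g x ** rng_comm (g y) c - g y ** rng_comm c (g x).
    rewrite (@eq_rng_comm _ (g x ** g y)); last by rewrite pM' !gK.
    by rewrite rng_comm_mul (rng_commC (g x)) rngmulN.
  rewrite phiB; [|exact: p_vectorM..].
  rewrite !phiM // !gK (rng_commC c) phiN /=; ring.
have dE c x : d c (p x) = phi (rng_comm x c).
  by rewrite /d; congr phi; apply: eq_rng_comm; rewrite gK.
exists K, idfun, (d a), (d b); split=> // [].
(* p a and p b separate the kernels: each derivation kills its own element and takes the value 1 or
   -1 on the other. *)
have dxx c : d c (p c) = 0 by rewrite dE /rng_comm subrr.
split=> sub.
  have /sub : p a \in der_kernel (d a) by rewrite inE dxx.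
  by rewrite inE dE phi1 oner_eq0.
have /sub : p b \in der_kernel (d b) by rewrite inE dxx.
by rewrite inE dE rng_commC phiN phi1 oppr_eq0 oner_eq0.
Qed.

End CentralKernel.

(* Hochschild 2-cocycles of K with values in the annihilator of m. *)
Record cocycle (K : fieldType) (Q : comNzRingType) (m : idealr Q) := Cocycle {
  scal : {rmorphism K -> Q};
  cocyc : K -> K -> Q;
  cocycDl : forall a b c, cocyc (a + b) c = cocyc a c + cocyc b c;
  cocycDr : forall a b c, cocyc a (b + c) = cocyc a b + cocyc a c;
  cocycA : forall a b c,
    scal a * cocyc b c + cocyc a (b * c) = cocyc (a * b) c + cocyc a b * scal c;
  cocyc_mem : forall a b, cocyc a b \in m;
  cocyc_mul : forall a b q, q \in m -> cocyc a b * q = 0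
}.

(** * The extension of K by m along a cocycle *)

Section Extension.
Variables (K : fieldType) (Q : comNzRingType) (m : idealr Q).

Definition ext_pred : {pred K * Q} := fun u => u.2 \in m.

Lemma ext_predE u : (u \in ext_pred) = (u.2 \in m). Proof. by []. Qed.

Lemma ext_pred_zmod_closed : zmod_closed ext_pred.
Proof. by split=> [|u v]; rewrite !ext_predE ?rpred0 //; apply: rpredB. Qed.
HB.instance Definition _ :=
  GRing.isZmodClosed.Build (K * Q)%type ext_pred ext_pred_zmod_closed.

Variable t : cocycle K m.

(** The carrier depends on m alone; the cocycle is kept as a parameter so that each one carries its
    own product. *)
Definition extension of cocycle K m : Type := {u : K * Q | u \in ext_pred}.
HB.instance Definition _ := SubChoice.on (extension t).
HB.instance Definition _ := [SubChoice_isSubZmodule of extension t by <:].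

Local Notation E := (extension t).

Lemma extensionP (u : E) : (val u).2 \in m. Proof. exact: valP u. Qed.

Definition ext_mul_val (u v : K * Q) : K * Q :=
  (u.1 * v.1,
   scal t u.1 * v.2 + scal t v.1 * u.2 + u.2 * v.2 + cocyc t u.1 v.1).

Lemma ext_mul_subproof (u v : E) : ext_mul_val (val u) (val v) \in ext_pred.
Proof.
rewrite unfold_in /=; have um := extensionP u; have vm := extensionP v.
by rewrite !rpredD ?cocyc_mem ?idealMr.
Qed.

Definition ext_mul (u v : E) : E :=
  exist (fun w => w \in ext_pred) _ (ext_mul_subproof u v).

Lemma ext_mulA : associative ext_mul.
Proof.
move=> u v w; apply: val_inj; rewrite /= /ext_mul_val /= mulrA.
congr (_, _); rewrite !rmorphM !(mulrDl, mulrDr) /=.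
have := cocycA t (val u).1 (val v).1 (val w).1.
have -> := cocyc_mul t (val u).1 (val v).1 (extensionP w).
rewrite [(val u).2 * cocyc _ _ _]mulrC.
have -> := cocyc_mul t (val v).1 (val w).1 (extensionP u).
move=> /eqP; rewrite -subr_eq => /eqP <-; ring.
Qed.

Lemma ext_mulDl : left_distributive ext_mul +%R.
Proof.
move=> u v w; apply: val_inj; rewrite /= /ext_mul_val /= mulrDl.
by congr (_, _); rewrite /= cocycDl rmorphD /=; ring.
Qed.

Lemma ext_mulDr : right_distributive ext_mul +%R.
Proof.
move=> u v w; apply: val_inj; rewrite /= /ext_mul_val /= mulrDr.
by congr (_, _); rewrite /= cocycDr rmorphD /=; ring.
Qed.

HB.instance Definition _ := Zmodule_isRng.Build E ext_mulA ext_mulDl ext_mulDr.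

Definition ext_ideal : {pred E} := fun u => (val u).1 == 0.

Lemma ext_ideal_zmod_closed : zmod_closed ext_ideal.
Proof.
split=> [|u v]; rewrite !unfold_in /= ?eqxx // => /eqP u0 /eqP v0.
by rewrite u0 v0 subrr.
Qed.
HB.instance Definition _ :=
  GRing.isZmodClosed.Build E ext_ideal ext_ideal_zmod_closed.

Lemma ext_idealMl (a : E) : {in ext_ideal, forall x, a ** x \in ext_ideal}.
Proof. by move=> x; rewrite !unfold_in /= => /eqP->; rewrite mulr0. Qed.

Lemma ext_idealMr (a : E) : {in ext_ideal, forall x, x ** a \in ext_ideal}.
Proof. by move=> x; rewrite !unfold_in /= => /eqP->; rewrite mul0r. Qed.

HB.instance Definition _ :=
  isRngIdeal.Build E ext_ideal ext_idealMl ext_idealMr.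

Local Notation I := (ext_ideal : rngIdeal E).

Lemma cocyc0l a : cocyc t 0 a = 0.
Proof. by apply: (addrI (cocyc t 0 a)); rewrite -cocycDl !addr0. Qed.

Lemma cocyc0r a : cocyc t a 0 = 0.
Proof. by apply: (addrI (cocyc t a 0)); rewrite -cocycDr !addr0. Qed.

Definition ext_of (a : K) (q : Q) (qm : q \in m) : E :=
  exist (fun w => w \in ext_pred) (a, q) qm.

Lemma ext_central : central_ideal I.
Proof.
move=> x; rewrite unfold_in => /eqP x0 y; apply: val_inj.
rewrite /= /ext_mul_val /= x0 cocyc0l cocyc0r.
congr (_, _); first by rewrite mulrC.
ring.
Qed.

Lemma ext_quot : rng_isomorphic (Quotient.quot I) (as_rng K).
Proof.
apply: (@quot_isomorphism E (as_rng K) I (fun u => (val u).1)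
  (fun a => @ext_of a 0 (rpred0 m))) => //.
Qed.

Lemma ext_noncommutative a b :
  cocyc t a b <> cocyc t b a -> noncommutative E.
Proof.
move=> nab /(_ (ext_of a (rpred0 m)) (ext_of b (rpred0 m))) /(congr1 val) /=.
by move=> [_]; rewrite /= !(mulr0, add0r).
Qed.

Lemma ext_ideal_sqr0 : {in m &, forall x y, x * y = 0} ->
  forall x : E, ideal_prod I I x <-> x = 0.
Proof.
move=> m0 x; split=> [|->]; last exact: ideal_prod0.
elim=> // [u v|u v _ -> _ ->]; last by rewrite subrr.
rewrite !unfold_in => /eqP u0 /eqP v0; apply: val_inj.
rewrite /= /ext_mul_val u0 v0 /= cocyc0l rmorph0 !mul0r !add0r addr0.
by rewrite m0 // extensionP.
Qed.

(** On the ideal the cocycle vanishes and the product is that of m, so factorizations in m carry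
    over. *)
Lemma ext_ideal_idempotent :
    {in m, forall x, exists y z, [/\ y \in m, z \in m & x = y * z]} ->
  forall x : E, x \in I <-> ideal_prod I I x.
Proof.
move=> mm x; split=> [|]; last first.
  elim=> [u v _ vI|//|u v _ uI _ vI]; [exact: rng_idealMl|exact: rpred0|].
  exact: rpredB.
rewrite unfold_in => /eqP x0.
have [y [z [ym zm xE]]] := mm _ (extensionP x).
have -> : x = ext_of 0 ym ** ext_of 0 zm.
  apply: val_inj; rewrite /= /ext_mul_val /= cocyc0l rmorph0 -xE.
  by rewrite !mul0r !add0r addr0 -x0 -surjective_pairing.
by apply: ideal_prod_mul; rewrite unfold_in /=.
Qed.

End Extension.

(** * The cocycle attached to two derivations *)

Section DerivationCocycle.
Variables (K L : fieldType) (iota : {rmorphism K -> L}) (d1 d2 : K -> L).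
Hypotheses (der1 : derivation iota d1) (der2 : derivation iota d2).
Variables (Q : comNzRingType) (m : idealr Q) (phi : {rmorphism L -> Q}) (s : Q).
Hypotheses (sm : s \in m) (s_mul : forall q, q \in m -> s * q = 0).

Definition derivation_cocycle : cocycle K m.
Proof.
apply: (@Cocycle K Q m (phi \o iota : {rmorphism K -> Q})
  (fun a b => phi (d1 a * d2 b) * s)) => [a b c|a b c|a b c|a b|a b q qm].
- by rewrite der1.1 mulrDl rmorphD mulrDl.
- by rewrite der2.1 mulrDr rmorphD mulrDl.
- by rewrite der1.2 der2.2 /= !(rmorphM, rmorphD) /=; ring.
- exact: idealMr.
- by rewrite -mulrA s_mul // mulr0.
Defined.

Lemma derivation_cocycle_asym : s != 0 ->
    incomparable (der_kernel d1) (der_kernel d2) ->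
  exists a b, cocyc derivation_cocycle a b <> cocyc derivation_cocycle b a.
Proof.
move=> s0 [n12 n21].
have wit (d d' : K -> L) : ~ {subset der_kernel d <= der_kernel d'} ->
    exists a : K, d a = 0 /\ d' a <> 0 :> L.
  move=> nsub; apply: contrapT => nex; apply: nsub => a.
  rewrite !inE => /eqP da.
  by apply/eqP; apply: contrapT => d'a; apply: nex; exists a.
(* The cocycle vanishes at (a, b), while at (b, a) it is a unit times s. *)
have [a [d1a d2a]] := @wit _ _ n12; have [b [d2b d1b]] := @wit _ _ n21.
exists a, b => /= /esym; rewrite d1a mul0r rmorph0 mul0r => e.
have nz : d1 b * d2 a != 0 by rewrite mulf_neq0 //; apply/eqP.
case/eqP: s0; rewrite -[s]mul1r -(rmorph1 phi) -(mulVf nz) rmorphM.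
by rewrite -mulrA e mulr0.
Qed.

End DerivationCocycle.

(** * Germs of truncated polynomials and their ideals *)

Section Germs.
Variable L : fieldType.

Local Notation S := (nat -> {poly L}).

(* Quotienting by this ideal yields the germs at infinity of the sequences in *)
(* the product of the L[X]/(X^(n+1)). *)
Definition germ_null : {pred S} :=
  fun p => `[< exists N, forall n, (N <= n)%N -> 'X^(n.+1) %| p n >].

Lemma germ_null_idealr_closed : idealr_closed germ_null.
Proof.
split=> [||a u v /asboolP[N uN] /asboolP[M vM]].
- by apply/asboolP; exists 0 => n _; apply: dvdp0.
- apply/asboolP => -[N /(_ N (leqnn N))] /dvdp_leq.
  by rewrite oner_eq0 size_polyXn size_poly1 => /(_ isT).
- apply/asboolP; exists (maxn N M) => n; rewrite geq_max => /andP[Nn Mn].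
  by rewrite dvdp_add ?dvdp_mull ?uN ?vM.
Qed.
HB.instance Definition _ := isIdealr.Build S germ_null germ_null_idealr_closed.

Definition germ : comNzRingType := {ideal_quot germ_null}.

Definition germ_of (p : S) : germ := \pi p.
HB.instance Definition _ :=
  GRing.RMorphism.copy germ_of (\pi_{ideal_quot germ_null}).

Lemma germ_eq0 (p : S) : germ_of p = 0 <->
  exists N, forall n, (N <= n)%N -> 'X^(n.+1) %| p n.
Proof.
rewrite -(rmorph0 germ_of); split=> [/eqP|pN].
  by rewrite -Quotient.idealrBE subr0 => /asboolP.
by apply/eqP; rewrite -Quotient.idealrBE subr0; apply/asboolP.
Qed.

Definition const_seq (c : L) : S := fun=> c%:P.

Lemma const_seq_zmod_morphism : zmod_morphism const_seq.
Proof. by move=> a b; apply/funext => n; rewrite /const_seq polyCB. Qed.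
Lemma const_seq_monoid_morphism : monoid_morphism const_seq.
Proof. by split=> // a b; apply/funext => n; rewrite /const_seq polyCM. Qed.
HB.instance Definition _ :=
  GRing.isZmodMorphism.Build L S const_seq const_seq_zmod_morphism.
HB.instance Definition _ :=
  GRing.isMonoidMorphism.Build L S const_seq const_seq_monoid_morphism.

Definition germ_const : {rmorphism L -> germ} := germ_of \o const_seq.

Definition germ_order (k : nat) (q : S) : germ :=
  germ_of (fun n => 'X^(n %/ k.+1) * q n).

Definition germ_socle : germ := germ_order 0 1.

Lemma germ_socle_neq0 : germ_socle != 0.
Proof.
apply/eqP => /germ_eq0[N /(_ N (leqnn N))]; rewrite divn1 mulr1 dvdp_Pexp2l.
  by rewrite ltnn.
by rewrite size_polyX.
Qed.

(** Once n > k the second factor contributes at least one X, so X^(n+1) divides the product; the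
    finitely many smaller n do not matter for germs. *)
Lemma germ_socle_mul k q : germ_socle * germ_order k q = 0.
Proof.
rewrite -rmorphM; apply/germ_eq0; exists k.+1 => n kn.
rewrite mulrfctE divn1 mulr1 mulrA -exprD dvdp_mulr // dvdp_exp2l //.
by rewrite -addn1 leq_add2l divn_gt0.
Qed.

(* If b is false, only k = 0 is allowed, and this is the ideal generated by *)
(* germ_socle; if b is true, these are the germs of linearly growing order. *)
Definition germ_ideal (b : bool) : {pred germ} :=
  fun x => `[< exists k q, (b || (k == 0)%N) /\ x = germ_order k q >].

Lemma germ_order_widen k l q : (k <= l)%N ->
  exists q', germ_order k q = germ_order l q'.
Proof.
move=> kl; exists (fun n => 'X^(n %/ k.+1 - n %/ l.+1) * q n).
congr germ_of; apply/funext => n; rewrite mulrA -exprD subnKC //.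
exact: leq_div2l.
Qed.

Lemma germ_ideal_idealr_closed b : idealr_closed (germ_ideal b).
Proof.
split=> [||a u v /asboolP[k [p [bk ->]]] /asboolP[l [q [bl ->]]]].
- apply/asboolP; exists 0%N, 0; rewrite orbT; split=> //.
  rewrite -(rmorph0 germ_of); congr germ_of; apply/funext => n.
  by rewrite mulr0.
- apply/asboolP => -[k [q [_ e]]].
  (* If 1 were in the ideal, it would annihilate the nonzero [germ_socle]. *)
  by case/eqP: germ_socle_neq0; rewrite -[LHS]mulr1 e germ_socle_mul.
have [p' ->] := germ_order_widen p (leq_maxl k l).
have [q' ->] := germ_order_widen q (leq_maxr k l).
have aE : a = germ_of (repr a) by rewrite /germ_of reprK.
apply/asboolP; exists (maxn k l), (repr a * p' + q').
split; first by case: b bk bl => //= /eqP-> /eqP->.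
rewrite aE -rmorphM -rmorphD -aE; congr germ_of; apply/funext => n.
by rewrite !(addrfctE, mulrfctE) mulrDr mulrCA.
Qed.
HB.instance Definition _ b :=
  isIdealr.Build germ (germ_ideal b) (germ_ideal_idealr_closed b).

Lemma germ_socle_mem b : germ_socle \in germ_ideal b.
Proof. by apply/asboolP; exists 0%N, 1; rewrite orbT. Qed.

Lemma germ_socle_annihilates b x : x \in germ_ideal b -> germ_socle * x = 0.
Proof. by move=> /asboolP[k [q [_ ->]]]; apply: germ_socle_mul. Qed.

Lemma germ_ideal_sqr0 : {in germ_ideal false &, forall x y, x * y = 0}.
Proof.
move=> x y /asboolP[k [q [/eqP-> ->]]] ym.
have -> : germ_order 0 q = germ_of q * germ_socle.
  rewrite -rmorphM; congr germ_of; apply/funext => n.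
  by rewrite mulrfctE mulr1 mulrC.
by rewrite -mulrA (germ_socle_annihilates ym) mulr0.
Qed.

Lemma germ_ideal_idempotent : {in germ_ideal true, forall x,
  exists y z, [/\ y \in germ_ideal true, z \in germ_ideal true & x = y * z]}.
Proof.
(* Since l + 1 = 2 (k + 1), twice n %/ (l + 1) is at most n %/ (k + 1); [e n] is the exponent left
   over. *)
move=> x /asboolP[k [q [_ ->]]]; pose l := (k.*2).+1.
pose e n := (n %/ k.+1 - n %/ l.+1 - n %/ l.+1)%N.
exists (germ_order l 1), (germ_order l (fun n => 'X^(e n) * q n)).
split; [apply/asboolP..|]; first by exists l, 1.
  by exists l, (fun n => 'X^(e n) * q n).
rewrite -rmorphM; congr germ_of; apply/funext => n.
rewrite mulrfctE mulr1 !mulrA -!exprD; congr ('X^_ * _).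
rewrite /e; have -> : (l.+1 = k.+1 * 2)%N by rewrite /l; lia.
rewrite divnMA; move: (n %/ k.+1)%N => j; lia.
Qed.

End Germs.

(** * The equivalences *)

Lemma derivations_extension (K L : fieldType) (iota : {rmorphism K -> L})
    (d1 d2 : K -> L) (b : bool) :
    derivation iota d1 -> derivation iota d2 ->
    incomparable (der_kernel d1) (der_kernel d2) ->
  exists t : cocycle K (germ_ideal b : idealr (germ L)),
    noncommutative (extension t).
Proof.
move=> der1 der2 inc.
pose t := derivation_cocycle der1 der2 (germ_const L) (germ_socle_mem L b)
  (@germ_socle_annihilates L b).
exists t; have [a [c ac]] := derivation_cocycle_asym der1 der2 (germ_const L)
  (germ_socle_mem L b) (@germ_socle_annihilates L b) (germ_socle_neq0 L) inc.
exact: ext_noncommutative ac.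
Qed.

(** For i, j in I: (i j) y = i (j y) = (j y) i = j (y i) = (y i) j = y (i j), as j y and y i lie in
    I. *)
Lemma idempotent_commutative_central (R : rngType) (I : rngIdeal R) :
    commutative_ideal I -> (forall x : R, x \in I <-> ideal_prod I I x) ->
  central_ideal I.
Proof.
move=> cI idI x /idI; elim=> [i j iI jI||u v _ uC _ vC] y.
- rewrite -rngmulA cI ?rng_idealMr // -rngmulA.
  by rewrite cI ?rng_idealMl // rngmulA.
- by rewrite rngmulx0 rngmul0x.
- by rewrite rngmulBl rngmulBr uC vC.
Qed.

Theorem theoremB (K : fieldType) :
  [<-> (exists (L : fieldType) (iota : {rmorphism K -> L}) (d1 d2 : K -> L),
          [/\ derivation iota d1,
              derivation iota d2
            & incomparable (der_kernel d1) (der_kernel d2)]);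
       (exists (R : rngType) (I : rngIdeal R),
          [/\ noncommutative R,
              central_ideal I,
              rng_isomorphic (Quotient.quot I) (as_rng K)
            & forall x : R, ideal_prod I I x <-> x = 0]);
       (exists (R : rngType) (I : rngIdeal R),
          [/\ noncommutative R,
              commutative_ideal I,
              forall x : R, x \in I <-> ideal_prod I I x
            & rng_isomorphic (Quotient.quot I) (as_rng K)]);
       (exists (R : rngType) (I : rngIdeal R),
          [/\ noncommutative R,
              central_ideal I
            & rng_isomorphic (Quotient.quot I) (as_rng K)])].
Proof.
have central_derivations : (exists (R : rngType) (I : rngIdeal R),
    [/\ noncommutative R, central_ideal I
      & rng_isomorphic (Quotient.quot I) (as_rng K)]) ->
    exists (L : fieldType) (iota : {rmorphism K -> L}) (d1 d2 : K -> L),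
      [/\ derivation iota d1, derivation iota d2
        & incomparable (der_kernel d1) (der_kernel d2)].
  move=> [R [I [ncR cI /quot_isomorphic_epi[p [g [pD pM gK ker_p]]]]]].
  apply: (@central_kernel_derivations R K p g pD pM gK _ ncR) => x px.
  by apply: cI; rewrite ker_p px.
tfae.
- move=> [L [iota [d1 [d2 [der1 der2 inc]]]]].
  have [t ncR] := derivations_extension false der1 der2 inc.
  exists (extension t), (@ext_ideal _ _ _ t : rngIdeal (extension t)).
  split=> //.
  + exact: ext_central.
  + exact: ext_quot.
  + exact/ext_ideal_sqr0/germ_ideal_sqr0.
- move=> [R [I [ncR cI isoK _]]].
  have [|L [iota [d1 [d2 [der1 der2 inc]]]]] := central_derivations.
    by exists R, I.
  have [t ncE] := derivations_extension true der1 der2 inc.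
  exists (extension t), (@ext_ideal _ _ _ t : rngIdeal (extension t)).
  split=> //.
  + by move=> x y xI _; apply: ext_central.
  + exact/ext_ideal_idempotent/germ_ideal_idempotent.
  + exact: ext_quot.
- move=> [R [I [ncR cI idI isoK]]]; exists R, I; split=> //.
  exact: idempotent_commutative_central.
- exact: central_derivations.
Qed.
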